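(* Let $\alpha$ and $\kappa$ be infinite cardinals, and let $\{X_i:i\in I\}$ be a set of topological spaces such that $|I|=\alpha$ and, for each $i\in I$, $X_i$ contains a subspace homeomorphic to the two-point discrete space and $w(X_i)\le\alpha$. Then (a) if $\kappa\le\alpha^+$ then $w((X_I)_\kappa)=\alpha^{<\kappa}$; (b) if $\kappa\ge\alpha^+$ then $w((X_I)_\kappa)=2^\alpha$.
   Context: No separation axioms are assumed. $w(X)$ is the weight of $X$ (least cardinality of a base). For a set $\{X_i:i\in I\}$ of spaces and an infinite cardinal $\kappa$, $(X_I)_\kappa$ is the set $X_I:=\prod_{i\in I}X_i$ with the $\kappa$-box topology, whose base consists of all sets $\prod_{i\in I}U_i$ with each $U_i$ open in $X_i$ and $|\{i\in I:U_i\ne X_i\}|<\kappa$. $\alpha^{<\kappa}:=\sum_{\lambda<\kappa}\alpha^\lambda$ (sum over cardinals $\lambda<\kappa$). $\alpha^+$ is the least cardinal greater than $\alpha$. *)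

(* Defs.v *)
From HB Require Import structures.
From mathcomp Require Import all_boot.
From mathcomp Require Import all_classical.
From mathcomp Require Import topology.

Set Implicit Arguments.
Unset Strict Implicit.
Unset Printing Implicit Defensive.

Local Open Scope classical_set_scope.
Local Open Scope card_scope.

(* There is no type of cardinals: a cardinal is given by a type or a set that
   has it, and cardinals are compared by #<= and #= of cardinality.v. *)

Definition card_lt (T U : Type) (A : set T) (B : set U) : Prop :=
  A #<= B /\ ~ (B #<= A).
Notation "A '#<' B" := (card_lt A B) (at level 79) : card_scope.

(* A member of F of least cardinality. By least_cardP below it exists as soon
   as F is nonempty. *)
Definition least_card (T : Type) (F : set (set T)) : set T :=
  get [set S | F S /\ forall S', F S' -> S #<= S'].

Lemma card_le_fun (T U : Type) (A : set T) (B : set U) (f : T -> U) :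
  set_fun A B f -> set_inj A f -> A #<= B.
Proof.
move=> fAB fi.
have /injfunPex[g] : exists2 g : T -> U, set_fun A B g & set_inj A g.
  by exists f.
exact: inj_card_le g.
Qed.

Lemma ex_least_card (T : Type) (F : set (set T)) : F !=set0 ->
  exists S, F S /\ forall S', F S' -> S #<= S'.
Proof.
move=> [S0 FS0].
pose good (P : set (set T -> T)) :=
  (forall f S, P f -> F S -> S (f S)) /\
  (forall f g S, P f -> P g -> F S -> f S = g S -> f = g).
have [G GP Gtot|P [[Pin Pinj] Pmax]] := @Zorn_bigcup _ good.
  split=> [f S [X GX Xf] FS|f g S [X GX Xf] [Y GY Yg] FS fg].
    exact: ((GP _ GX).1 _ _ Xf FS).
  have [XY|YX] := Gtot _ _ GX GY.
    exact: ((GP _ GY).2 _ _ _ (XY _ Xf) Yg FS fg).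
  exact: ((GP _ GX).2 _ _ _ Xf (YX _ Yg) FS fg).
have [S [FS Ssurj]] : exists S, F S /\ forall y, S y -> exists2 f, P f & f S = y.
  apply: contrapT => noS.
  have miss S : F S -> exists y, S y /\ forall f, P f -> f S <> y.
    move=> FS; apply: contrapT => nomiss; apply: noS; exists S; split=> // y Sy.
    apply: contrapT => nof; apply: nomiss; exists y; split=> // f Pf fy.
    by apply: nof; exists f.
  have [t0 _] := miss _ FS0.
  have /choice[f0 f0P] : forall S, exists y,
      F S -> S y /\ forall f, P f -> f S <> y.
    move=> S; have [/miss[y Hy]|nFS] := pselect (F S); first by exists y.
    by exists t0.
  apply: (Pmax (P `|` [set f0])).
    split; first by move=> f Pf; left.
    by move=> /(_ f0 (or_intror erefl)) /((f0P _ FS0).2 f0).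
  split=> [f S [Pf|->] FS|f g S [Pf|->] [Pg|->] FS fg //].
  - exact: (Pin _ _ Pf FS).
  - exact: ((f0P _ FS).1).
  - exact: (Pinj _ _ _ Pf Pg FS fg).
  - by have := (f0P _ FS).2 f Pf.
  - by have := (f0P _ FS).2 g Pg; rewrite fg.
exists S; split=> // S' FS'.
have [[f Pf]|noP] := pselect (exists f, P f); last first.
  have -> : S = set0.
    by rewrite -subset0 => y /Ssurj[f Pf _]; apply: noP; exists f.
  exact: card_ge0.
have /choice[h hP] : forall y, exists g, P g /\ (S y -> g S = y).
  move=> y; have [/Ssurj[g Pg gy]|nSy] := pselect (S y); first by exists g.
  by exists f.
apply: (@card_le_fun _ _ _ _ (fun y => h y S')).
  by move=> y _; exact: (Pin _ _ (hP y).1 FS').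
move=> y z /set_mem Sy /set_mem Sz e.
rewrite -((hP y).2 Sy) -((hP z).2 Sz).
by rewrite (Pinj _ _ _ (hP y).1 (hP z).1 FS' e).
Qed.

Lemma least_cardP (T : Type) (F : set (set T)) : F !=set0 ->
  F (least_card F) /\ forall S, F S -> least_card F #<= S.
Proof. by move=> /ex_least_card/getPex. Qed.

Lemma card_le_total (T U : Type) (A : set T) (B : set U) :
  A #<= B \/ B #<= A.
Proof.
have Al : (@inl T U) @` A #= A by apply: inj_card_eq => x y _ _ [].
have Br : (@inr T U) @` B #= B by apply: inj_card_eq => x y _ _ [].
have [|S [[->|->] Smin]] := @ex_least_card _ [set inl @` A; inr @` B].
- by exists (inl @` A); left.
- left; rewrite -(card_le_eql Al) -(card_le_eqr Br).
  by apply: Smin; right.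
- right; rewrite -(card_le_eql Br) -(card_le_eqr Al).
  by apply: Smin; left.
Qed.

Lemma card_le_ex (T U : Type) (u0 : U) (A : set T) (B : set U) :
  A #<= B -> exists f : T -> U, set_fun A B f /\ set_inj A f.
Proof.
elim/Ppointed: U => U in u0 B *; first by case: (no u0).
move=> /pcard_leP[f]; exists f; split; [exact: funS|exact: inj].
Qed.

Lemma infinite_dup (T : Type) (S : set T) : infinite_set S ->
  exists d : bool -> T -> T, (forall b x, S x -> S (d b x)) /\
    forall b c x y, S x -> S y -> d b x = d c y -> b = c /\ x = y.
Proof.
move=> Sinf.
have [t0 _] : S !=set0 by apply/set0P/eqP => S0; apply: Sinf; rewrite S0.
pose good (P : set (nat -> T)) := (forall f n, P f -> S (f n)) /\
  (forall f g n m, P f -> P g -> f n = g m -> f = g /\ n = m).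
have [G GP Gtot|P [[Pin Pinj] Pmax]] := @Zorn_bigcup _ good.
  split=> [f n [X GX Xf]|f g n m [X GX Xf] [Y GY Yg] fg].
    exact: ((GP _ GX).1 _ _ Xf).
  have [XY|YX] := Gtot _ _ GX GY.
    exact: ((GP _ GY).2 _ _ _ _ (XY _ Xf) Yg fg).
  exact: ((GP _ GX).2 _ _ _ _ Xf (YX _ Yg) fg).
pose R := [set x | exists f n, P f /\ x = f n].
have Cfin : finite_set (S `\` R).
  apply: contrapT => /infiniteP/(card_le_ex t0)[g [gC ginj]].
  have gnR n : ~ R (g n) by have [] := gC n I.
  have gnP f n m : P f -> f n <> g m.
    by move=> Pf e; apply: (gnR m); exists f, n.
  apply: (Pmax (P `|` [set g])).
    split; first by move=> f Pf; left.
    by move=> /(_ g (or_intror erefl)) Pg; apply: (gnR 0); exists g, 0.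
  split=> [f n [Pf|->]|f h n m [Pf|->] [Ph|->] fh].
  - exact: (Pin _ _ Pf).
  - by have [] := gC n I.
  - exact: (Pinj _ _ _ _ Pf Ph).
  - by case: (gnP _ _ _ Pf fh).
  - by case: (gnP _ _ _ Ph (esym fh)).
  - by split=> //; apply: ginj; rewrite ?in_setT.
have [f0 Pf0] : exists f, P f.
  apply: contrapT => noP; apply: Sinf; suff <- : S `\` R = S by [].
  apply/seteqP; split=> [x []//|x Sx]; split=> // -[f [n [Pf _]]].
  by apply: noP; exists f.
have /choice[u uP] : forall x, exists fn : (nat -> T) * nat,
    R x -> P fn.1 /\ x = fn.1 fn.2.
  move=> x; have [[f [n [Pf xf]]]|nR] := pselect (R x).
    by exists (f, n).
  by exists (f0, 0).
pose dbl (b : bool) x := (u x).1 (b + (u x).2.*2).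
have dblR b x : R x -> R (dbl b x).
  by move=> /uP[Pu _]; exists (u x).1, (b + (u x).2.*2).
have dbl_inj b c x y : R x -> R y -> dbl b x = dbl c y -> b = c /\ x = y.
  move=> /uP[Px xE] /uP[Py yE] /(Pinj _ _ _ _ Px Py)[e1 e2].
  have bc : b = c.
    by move: (congr1 odd e2); rewrite !oddD !odd_double !addbF !oddb.
  split=> //; rewrite xE yE e1; congr (_ _).
  by move: e2; rewrite bc => /addnI/double_inj.
have [e [_ einj]] : exists e : T -> nat,
    set_fun (S `\` R) setT e /\ set_inj (S `\` R) e.
  exact/(card_le_ex 0)/finite_set_countable.
pose h x := if `[< R x >] then dbl false x else f0 (e x).*2.+1.
have hR x : S x -> R (h x).
  by rewrite /h; case: asboolP => [/dblR//|_ _]; exists f0, (e x).*2.+1.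
have mixed x k : R x -> dbl false x <> f0 k.*2.+1.
  move=> /uP[Px _] /(Pinj _ _ _ _ Px Pf0)[_ /(congr1 odd)].
  by rewrite /= add0n !odd_double.
have h_inj x y : S x -> S y -> h x = h y -> x = y.
  rewrite /h => Sx Sy; case: asboolP => Rx; case: asboolP => Ry.
  - by move=> /(dbl_inj _ _ _ _ Rx Ry)[].
  - by move=> /mixed.
  - by move=> /esym/mixed.
  - move=> /(Pinj _ _ _ _ Pf0 Pf0)[_ [/double_inj]].
    by apply: einj; apply/mem_set.
exists (fun b x => dbl b (h x)); split=> [b x /hR/(dblR b)|b c x y Sx Sy].
  by move=> [f [n [Pf ->]]]; exact: (Pin _ _ Pf).
by move=> /(dbl_inj _ _ _ _ (hR _ Sx) (hR _ Sy))[-> /(h_inj _ _ Sx Sy)].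
Qed.

Lemma card_lt_setU (K T : Type) (S1 S2 : set T) : infinite_set [set: K] ->
  S1 #< [set: K] -> S2 #< [set: K] -> (S1 `|` S2) #< [set: K].
Proof.
move=> Kinf.
wlog S12 : S1 S2 / S1 #<= S2 => [wl S1K S2K|S1K S2K].
  have [/wl|/wl] := card_le_total S1 S2; first exact.
  by rewrite setUC; exact.
suff : ~ ([set: K] #<= S1 `|` S2).
  by have [] := card_le_total (S1 `|` S2) [set: K].
have [S2fin|S2inf] := pselect (finite_set S2).
  move=> /card_le_finite KS; apply/Kinf/KS; rewrite finite_setU; split=> //.
  exact: card_le_finite S12 S2fin.
move=> /card_le_trans KS; apply: S2K.2; apply: KS.
have [t0 _] : S2 !=set0 by apply/set0P/eqP => S0; apply: S2inf; rewrite S0.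
have [d [dS dinj]] := infinite_dup S2inf.
have [g [gS ginj]] := card_le_ex t0 S12.
apply: (@card_le_fun _ _ _ _
    (fun x => if `[< S2 x >] then d true x else d false (g x))).
  move=> x S12x; case: asboolP => S2x; first exact: dS.
  by apply/dS/gS; case: S12x.
move=> x y /set_mem S12x /set_mem S12y.
case: asboolP => S2x; case: asboolP => S2y.
- by move=> /(dinj _ _ _ _ S2x S2y)[].
- have S1y : S1 y by case: S12y.
  by move=> /(dinj _ _ _ _ S2x (gS _ S1y))[].
- have S1x : S1 x by case: S12x.
  by move=> /(dinj _ _ _ _ (gS _ S1x) S2y)[].
- have S1x : S1 x by case: S12x.
  have S1y : S1 y by case: S12y.
  move=> /(dinj _ _ _ _ (gS _ S1x) (gS _ S1y))[_].
  by apply: ginj; apply/mem_set.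
Qed.

(* The successor of the cardinal of A. The search ranges over subsets of the
   type set A, but the result is least among all cardinals greater than that
   of A: see card_succP. *)
Definition card_succ (A : Type) : set (set A) :=
  least_card [set S : set (set A) | [set: A] #< S].
Arguments card_succ : clear implicits.

Lemma card_lt_powerset (A : Type) : [set: A] #< [set: set A].
Proof.
split.
  apply: (@card_le_fun _ _ _ _ (fun x => [set x])) => // x y _ _ xy.
  by have : [set x] x by []; rewrite xy.
have [[a0 _]|nA] := pselect (exists a : A, True); last first.
  have -> : [set: A] = set0 by rewrite -subset0 => a _; apply: nA; exists a.
  move=> /card_le0P T0.
  by have : [set: set A] set0 by []; rewrite T0.
move=> /(card_le_ex a0)[e [_ einj]].
pose D := [set x | exists2 S : set A, e S = x & ~ S x].
have [De|nDe] := pselect (D (e D)).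
  have [S eS nS] := De; apply: nS.
  by have -> : S = D by apply: einj => //; rewrite in_setT.
by apply: (nDe); exists D.
Qed.

Lemma card_succP (A : Type) : [set: A] #< card_succ A /\
  forall (U : Type) (B : set U), [set: A] #< B -> card_succ A #<= B.
Proof.
have [] := @least_cardP _ [set S : set (set A) | [set: A] #< S].
  by exists setT; exact: card_lt_powerset.
move=> As smin; split=> // U B [AB nBA].
have [|BA] := card_le_total [set: set A] B.
  exact/card_le_trans/card_leT.
have [g [_ ginj]] := card_le_ex set0 BA.
have gB : g @` B #= B by exact: inj_card_eq.
rewrite -(card_le_eqr gB); apply: smin; split; first by rewrite (card_le_eqr gB).
by rewrite (card_le_eql gB).
Qed.

(* Each cardinal smaller than that of K is the cardinal of a subset of K, and
   cards_below K holds exactly one subset of K of each such cardinal, because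
   get depends only on the class of the sets equipotent to S. *)
Definition cards_below (K : Type) : set (set K) :=
  [set get [set S' : set K | S' #= S] | S in [set S : set K | S #< [set: K]]].
Arguments cards_below : clear implicits.

Lemma cards_belowP (K T : Type) (S : set T) : S #< [set: K] ->
  exists! L : set K, cards_below K L /\ L #= S.
Proof.
move=> SK.
have [S' SS'] : exists S' : set K, S' #= S.
  have [k0 _] : exists k : K, True.
    apply: contrapT => nK; apply: SK.2.
    have -> : [set: K] = set0 by rewrite -subset0 => k _; apply: nK; exists k.
    exact: card_ge0.
  have [g [_ ginj]] := card_le_ex k0 SK.1.
  by exists (g @` S); exact: inj_card_eq.
have getE (R : set K) : get [set S0 : set K | S0 #= R] #= R.
  by apply: (@getPex _ [set S0 : set K | S0 #= R]); exists R => /=.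
have S'K : S' #< [set: K].
  by split; [rewrite (card_le_eql SS') SK.1|rewrite (card_le_eqr SS'); exact: SK.2].
exists (get [set S0 : set K | S0 #= S']); split.
  split; first by exists S'.
  exact: card_eq_trans (getE S') SS'.
move=> _ [[R RK <-] RS].
have RS' : R #= S'.
  apply: card_eq_trans (card_esym (getE R)) _.
  exact: card_eq_trans RS (card_esym SS').
congr get; apply/seteqP; split=> S0 /= S0R.
  exact: card_eq_trans S0R (card_esym RS').
exact: card_eq_trans S0R RS'.
Qed.

(* The disjoint union, over the cardinals L smaller than that of K, of the
   sets of functions from L to A; its cardinal is that of A to the weak power
   of that of K. *)
Definition weak_power (A K : Type) : Type :=
  {L : set_type (cards_below K) & set_type (\val L) -> A}.

Definition weight (X : topologicalType) : set (set X) :=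
  least_card (@basis X).
Arguments weight : clear implicits.

Lemma weightP (X : topologicalType) :
  basis (weight X) /\ forall B : set (set X), basis B -> weight X #<= B.
Proof.
apply: least_cardP; exists open; split=> // x U.
rewrite nbhsE => -[V [oV Vx] VU]; by exists V.
Qed.

Definition homeomorphic (X Y : topologicalType) : Prop :=
  exists (f : X -> Y) (g : Y -> X),
    [/\ cancel f g, cancel g f, continuous f & continuous g].

Definition contains_two_point_discrete (X : topologicalType) : Prop :=
  exists S : set X, homeomorphic (set_type S) bool.

Section BoxTopology.
Variables (K : Type) (infK : infinite_set [set: K]).
Variables (I : Type) (X : I -> topologicalType).

(* The product set with the kappa-box topology, kappa being the cardinal of K.
   It depends on infK because the boxes need not form a base otherwise. *)
Definition box_product of infinite_set [set: K] := forall i, X i.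

Definition box_base : set (set (forall i, X i)) :=
  [set [set x | forall i, U i (x i)] | U in
    [set U : forall i, set (X i) |
      (forall i, open (U i)) /\ [set i | U i <> setT] #< [set: K]]].

Local Notation W := (box_product infK).

Let box_cover : \bigcup_(B in box_base) B = [set: W].
Proof.
rewrite -subTset => x _; exists setT => //.
exists (fun=> setT); last by apply/seteqP; split.
split=> [i|]; first exact: openT.
have -> : [set i : I | [set: X i] <> setT] = set0.
  by rewrite -subset0 => i; apply.
split=> // /card_le0P K0; apply: infK; rewrite K0; exact: finite_set0.
Qed.

Let box_join (B C : set W) (x : W) : box_base B -> box_base C -> B x -> C x ->
  exists D : set W, [/\ box_base D, D x & D `<=` B `&` C].
Proof.
move=> [U [oU UK] <-] [V [oV VK] <-] Ux Vx.
exists [set x : W | forall i, (U i `&` V i) (x i)]; split=> //.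
  exists (fun i => U i `&` V i) => //; split=> [i|]; first exact: openI.
  have sub : [set i | U i `&` V i <> setT] `<=`
      [set i | U i <> setT] `|` [set i | V i <> setT].
    move=> i /= UV; apply: contrapT => /not_orP[/contrapT UT /contrapT VT].
    by apply: UV; rewrite UT VT setIT.
  have [le nle] := card_lt_setU infK UK VK.
  split; first exact: card_le_trans (subset_card_le sub) le.
  by move=> /card_le_trans/(_ (subset_card_le sub)).
by move=> y UVy; split=> i; case: (UVy i).
Qed.

HB.instance Definition _ := Choice.on W.
HB.instance Definition _ :=
  @isBaseTopological.Build W (set W) box_base id box_cover box_join.

Lemma basis_box_base : basis (box_base : set (set W)).
Proof.
split=> [B BB|x U].
  exists [set B]; first by move=> _ ->.
  by rewrite bigcup_set1.
rewrite nbhsE => -[V [[D DB <-] [B DBB Bx]] VU].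
exists B; first by split=> //; exact: DB.
by move=> y By; apply: VU; exists B.
Qed.

End BoxTopology.

(* Main.v *)
(* Write [A]^{<K} for the family of subsets of A of cardinal less than K. In
   both cases the weight is the cardinal of [A]^{<K}. It is at most that,
   because a basic box is coded by fewer than K pairs (coordinate, member of a
   base of the factor), and there are as many pairs as elements of A. It is at
   least that: if p_i is outside an open V_i containing q_i, then the point x_S
   with value q_i for i in S and p_i elsewhere lies in the box of the V_i,
   i in S', only if S' is contained in S, so base members chosen around the
   points x_S inside the boxes of S are distinct. Finally, [A]^{<K} has the
   cardinal of the weak power when K is at most the successor of A, functions
   from L to A being identified with their graphs, and contains every subset
   of A when K is at least the successor of A. *)
Require Import Defs.
From mathcomp Require Import all_boot.
From mathcomp Require Import all_classical.
From mathcomp Require Import topology.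

Set Implicit Arguments.
Unset Strict Implicit.
Unset Printing Implicit Defensive.

Local Open Scope classical_set_scope.
Local Open Scope card_scope.

(** * Injections and the square of an infinite cardinal *)

Lemma inj_card_leT (T U : Type) (f : T -> U) :
  injective f -> [set: T] #<= [set: U].
Proof. by move=> f_inj; apply: (@card_le_fun _ _ _ _ f) => // x y _ _ /f_inj. Qed.

Lemma card_leT_inj (T U : Type) (u0 : U) :
  [set: T] #<= [set: U] -> exists f : T -> U, injective f.
Proof.
move=> /(card_le_ex u0)[f [_ f_inj]]; exists f => x y.
by apply: f_inj; rewrite in_setT.
Qed.

(** The pairs to which Zorn's lemma is applied: [f] restricts to an injection of [S * S] into [S].
    Taking [f] total on [T] avoids dependent types. *)
Definition square_inj (T : Type) (S : set T) (f : T -> T -> T) : Prop :=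
  [/\ infinite_set S, forall x y, S x -> S y -> S (f x y) &
    forall x y x' y', S x -> S y -> S x' -> S y' ->
      f x y = f x' y' -> x = x' /\ y = y'].

(** A copy of the natural numbers in [T], with pairs coded by [pickle], is the starting point for
    Zorn's lemma. *)
Lemma square_inj_nat (T : Type) : infinite_set [set: T] ->
  exists (S : set T) (f : T -> T -> T), square_inj S f.
Proof.
move=> /[dup] /infinite_setN0[t0 _] /infiniteP/(card_leT_inj t0)[h h_inj].
have /choice[k hK] : forall x, exists n, range h x -> h n = x.
  move=> x; have [[n _ <-]|nx] := pselect (range h x); first by exists n.
  by exists 0.
exists (range h), (fun x y => h (pickle (k x, k y))); split.
- apply/infiniteP; apply: (@card_le_fun _ _ _ _ h) => [n _|n m _ _ /h_inj//].
  by exists n.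
- by move=> x y _ _; exists (pickle (k x, k y)).
- move=> x y x' y' Sx Sy Sx' Sy' /h_inj/(pcan_inj pickleK)[kx ky].
  by rewrite -(hK _ Sx) kx -(hK _ Sy) ky !hK.
Qed.

(* If S is smaller than T then its complement contains a copy g @` S of S, and
   the new pairs, as many as those of S, are sent into that copy. *)
Lemma square_inj_extend (T : Type) (S : set T) (f : T -> T -> T) :
  square_inj S f -> ~ ([set: T] #<= S) ->
  exists (S' : set T) (f' : T -> T -> T), [/\ square_inj S' f', S `<=` S',
    forall x y, S x -> S y -> f' x y = f x y & ~ (S' `<=` S)].
Proof.
move=> [Sinf fS f_inj] TS.
have Tinf : infinite_set [set: T] by exact: sub_infinite_set Sinf.
have [t0 _] := infinite_setN0 Sinf.
(* Otherwise [T] would be the union of [S] and its complement, both smaller than [T]. *)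
have SC : S #<= ~` S.
  have [//|CS] := card_le_total S (~` S); exfalso.
  have ST : S #< [set: T] by split; first exact: card_leT.
  have CT : ~` S #< [set: T].
    by split; [exact: card_leT|move=> /card_le_trans/(_ CS)].
  by have [_] := card_lt_setU Tinf ST CT; rewrite setUv; apply; exact: card_lexx.
have [g [gC g_inj]] := card_le_ex t0 SC.
have gI x y : S x -> S y -> g x = g y -> x = y.
  by move=> Sx Sy; apply: g_inj; apply/mem_set.
have nSg x : S x -> ~ S (g x) by move=> /gC.
have [d [dS d_inj]] := infinite_dup Sinf.
pose S' := S `|` g @` S.
have /choice[r rP] : forall x, exists y, S' x -> S y /\ (~ S x -> g y = x).
  move=> x; have [Sx|nSx] := pselect (S x); first by exists x.
  have [[y Sy gy]|ngx] := pselect ((g @` S) x); first by exists y.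
  by exists x => -[].
have rS x : S' x -> S (r x) by move=> /rP[].
pose flag x := `[< S x >].
pose s x := if flag x then x else r x.
have sS x : S' x -> S (s x).
  by rewrite /s /flag; case: asboolP => // _ /rS.
have s_inj x y : S' x -> S' y -> flag x = flag y -> s x = s y -> x = y.
  rewrite /s /flag => S'x S'y; case: asboolP => Sx; case: asboolP => Sy //= _ e.
  by rewrite -((rP _ S'x).2 Sx) -((rP _ S'y).2 Sy) e.
(* [s] replaces a new point by its preimage under [g]; the two uses of [d] record which coordinates
   were new, so [h] is injective on pairs from [S']. *)
pose h x y := d (flag x) (d (flag y) (f (s x) (s y))).
have hS x y : S' x -> S' y -> S (h x y).
  by move=> /sS Sx /sS Sy; apply/dS/dS/fS.
have h_inj x y x' y' : S' x -> S' y -> S' x' -> S' y' ->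
    h x y = h x' y' -> x = x' /\ y = y'.
  move=> X Y X' Y' /d_inj[]; [by apply/dS/fS; exact: sS..|].
  move=> fx /d_inj[]; [by apply/fS; exact: sS..|].
  move=> fy /f_inj[]; [exact: sS..|].
  by move=> sx sy; split; exact: s_inj.
pose f' x y := if flag x && flag y then f x y else g (h x y).
have f'P x y : (S x /\ S y /\ f' x y = f x y) \/
    (~ (S x /\ S y) /\ f' x y = g (h x y)).
  rewrite /f' /flag; case: asboolP => Sx; case: asboolP => Sy /=;
    by [left|right; split=> // -[]].
exists S', f'; split.
- split.
  + by apply: sub_infinite_set Sinf => x; left.
  + move=> x y S'x S'y.
    have [[Sx [Sy ->]]|[_ ->]] := f'P x y; first by left; apply: fS.
    by right; exists (h x y) => //; exact: hS.
  + move=> x y x' y' S'x S'y S'x' S'y'.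
    have [[Sx [Sy ->]]|[_ ->]] := f'P x y;
      have [[Sx' [Sy' ->]]|[_ ->]] := f'P x' y'.
    * exact: f_inj.
    * move=> e; have := nSg _ (hS _ _ S'x' S'y'); case; rewrite -e; exact: fS.
    * move=> e; have := nSg _ (hS _ _ S'x S'y); case; rewrite e; exact: fS.
    * by move=> /gI/h_inj; apply => //; exact: hS.
- by move=> x; left.
- move=> x y Sx Sy; have [[_ [_ ->]]//|[nS _]] := f'P x y.
  by exfalso; apply: nS.
- have [x Sx] := infinite_setN0 Sinf.
  by move=> /(_ (g x)) S'S; apply: (nSg x Sx); apply: S'S; right; exists x.
Qed.

(** Zorn's lemma yields a maximal pair; by [square_inj_extend] its set is as large as [T], so its
    injection transfers to [T]. *)
Lemma card_le_square (T : Type) : infinite_set [set: T] ->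
  [set: T * T] #<= [set: T].
Proof.
move=> Tinf.
have [S0 [f0 good0]] := square_inj_nat Tinf.
pose good (t : set T * (T -> T -> T)) := square_inj t.1 t.2.
pose below (s t : {t | good t}) := (sval s).1 `<=` (sval t).1 /\
  forall x y, (sval s).1 x -> (sval s).1 y -> (sval t).2 x y = (sval s).2 x y.
have below_trans r s t : below r s -> below s t -> below r t.
  move=> [rs rsE] [st stE]; split=> [|x y rx ry]; first exact: subset_trans st.
  by rewrite stE ?rsE //; exact: rs.
pose t0 : {t | good t} := exist good (S0, f0) good0.
(* [below] is only a preorder: two functions may agree on [S] and differ elsewhere. *)
have [||C Ctot|t tmax] := @ZL_preorder _ t0 (fun s t => `[< below s t >]).
- by move=> s; apply/asboolP; split.
- move=> r s t /asboolP rs /asboolP st; apply/asboolP.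
  exact: below_trans rs st.
- have {}Ctot s t : C s -> C t -> below s t \/ below t s.
    by move=> Cs Ct; have [/asboolP|/asboolP] := Ctot _ _ Cs Ct; [left|right].
  have [C0|nC0] := pselect (C !=set0); last first.
    by exists t0 => s Cs; exfalso; apply: nC0; exists s.
  have [c0 Cc0] := C0.
  pose S := \bigcup_(c in C) (sval c).1.
  have S2 x y : S x -> S y -> exists c, [/\ C c, (sval c).1 x & (sval c).1 y].
    move=> [c Cc cx] [c' Cc' cy].
    have [[cc' _]|[cc' _]] := Ctot _ _ Cc Cc'.
      by exists c'; split=> //; exact: cc'.
    by exists c; split=> //; exact: cc'.
  (* Members of the chain extend one another, so their values at a pair agree and define [f] on the
     union; elsewhere [x] is a default. *)
  have /choice[f fP] : forall p, exists z, forall c, C c ->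
      (sval c).1 p.1 -> (sval c).1 p.2 -> z = (sval c).2 p.1 p.2.
    move=> [x y] /=; have [[Sx Sy]|nS] := pselect (S x /\ S y); last first.
      exists x => c Cc cx cy; exfalso; apply: nS; split; by exists c.
    have [c [Cc cx cy]] := S2 _ _ Sx Sy; exists ((sval c).2 x y) => c' Cc' cx' cy'.
    by have [[_ ->]|[_ ->]] := Ctot _ _ Cc Cc'.
  have fE c x y : C c -> (sval c).1 x -> (sval c).1 y ->
      f (x, y) = (sval c).2 x y.
    by move=> Cc cx cy; rewrite (fP (x, y) c).
  have Sgood : good (S, fun x y => f (x, y)).
    split=> /=.
    + have [c0inf _ _] := svalP c0.
      by apply: sub_infinite_set c0inf => x cx; exists c0.
    + move=> x y /S2 Sxy /Sxy[c [Cc cx cy]]; rewrite (fE c) //; exists c => //.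
      by have [_ + _] := svalP c; apply.
    + move=> x y x' y' /S2 Sxy /Sxy[c [Cc cx cy]] /S2 Sxy' /Sxy'[c' [Cc' cx' cy']].
      rewrite (fE c) // (fE c') //.
      have [[cc' cc'E]|[cc' cc'E]] := Ctot _ _ Cc Cc'.
        rewrite -cc'E //.
        by have [_ _] := svalP c'; apply => //; exact: cc'.
      rewrite -[RHS]cc'E //.
      by have [_ _] := svalP c; apply => //; exact: cc'.
  exists (exist good _ Sgood) => c Cc; apply/asboolP; split=> /= [x cx|x y cx cy].
    by exists c.
  exact: fE.
- have [Sinf fS f_inj] := svalP t.
  have [/(card_le_ex (sval (cid (infinite_setN0 Tinf))))[e [eS e_inj]]|TS] :=
      pselect ([set: T] #<= (sval t).1).
    have eI x y : e x = e y -> x = y by apply: e_inj; rewrite in_setT.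
    apply: (inj_card_leT (f := fun p => (sval t).2 (e p.1) (e p.2))).
    move=> [x y] [x' y'] /f_inj[]; [exact: eS..|].
    by move=> /eI /= -> /eI ->.
  have [S' [f' [good' SS' ff' nS'S]]] := square_inj_extend (svalP t) TS.
  (* Maximality puts the extension below [t] in turn, so [S'] adds no point. *)
  have /tmax/asboolP[S'S _] : `[< below t (exist good (S', f') good') >].
    by apply/asboolP; split.
  by have := nS'S S'S.
Qed.

(** * Small subsets and weak powers *)

Definition subsets_lt (K T : Type) : set (set T) := [set S | S #< [set: K]].
Arguments subsets_lt : clear implicits.

Lemma card_le_lt (T U V : Type) (R : set T) (S : set U) (B : set V) :
  R #<= S -> S #< B -> R #< B.
Proof.
move=> RS [SB BS]; split; first exact: card_le_trans SB.
by move=> /card_le_trans/(_ RS).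
Qed.

Lemma subsets_lt_le (K T U : Type) (f : T -> U) : injective f ->
  subsets_lt K T #<= subsets_lt K U.
Proof.
move=> f_inj; apply: (@card_le_fun _ _ _ _ (fun S => f @` S)).
  by move=> S; apply: card_le_lt; exact: card_image_le.
have sub S S' : f @` S = f @` S' -> S `<=` S'.
  move=> e x Sx; have [y S'y /f_inj <- //] : (f @` S') (f x).
  by rewrite -e; exists x.
by move=> S S' _ _ e; apply/seteqP; split; apply: sub.
Qed.

Lemma card_lt_weak_exponent (K : Type) (L : set_type (cards_below K)) :
  \val L #< [set: K].
Proof.
have [S SK <-] := set_valP L; apply: card_le_lt (SK).
have : get [set S' : set K | S' #= S] #= S.
  by apply: (@getPex _ [set S' : set K | S' #= S]); exists S => /=.
by rewrite card_eq_le => /andP[].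
Qed.

Lemma weak_exponent_inj (K : Type) (L M : set_type (cards_below K)) :
  \val L #= \val M -> L = M.
Proof.
move=> LM; apply: val_inj.
have [N [_ NP]] := cards_belowP (card_lt_weak_exponent M).
by rewrite -(NP (\val L)) ?(NP (\val M)) //; split=> //; exact: set_valP.
Qed.

(* The graph of a function on L has the cardinal of L, and therefore
   determines L among the members of cards_below K. *)
Lemma weak_power_le (A K : Type) (a0 : A) : [set: K] #<= card_succ A ->
  [set: weak_power A K] #<= subsets_lt K (A * A).
Proof.
move=> KA.
have /choice[j j_inj] : forall L : set_type (cards_below K), exists j : K -> A,
    set_inj (\val L) j.
  move=> L; have LK := card_lt_weak_exponent L.
  have [/(card_le_ex a0)[j [_ j_inj]]|LA] := pselect (\val L #<= [set: A]).
    by exists j.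
  (* If [A] were smaller than [L], its successor, and hence [K], would be at most [L]. *)
  exfalso; have [//|AL] := card_le_total (\val L) [set: A].
  by apply: LK.2; apply: card_le_trans KA _; apply: (card_succP A).2.
have jI (L : set_type (cards_below K)) (l m : set_type (\val L)) :
    j L (\val l) = j L (\val m) -> l = m.
  by move=> e; apply/val_inj/(j_inj L) => //; apply/mem_set; exact: set_valP.
pose graph (p : weak_power A K) :=
  [set (j (projT1 p) (\val l), projT2 p l) | l in setT].
have card_graph p : graph p #= \val (projT1 p).
  apply: card_eq_trans (card_setT _); apply: inj_card_eq => l m _ _ [/jI].
  by [].
apply: (@card_le_fun _ _ _ _ graph) => [p _|p q _ _ pq].
  apply: card_le_lt (card_lt_weak_exponent (projT1 p)).
  by have := card_graph p; rewrite card_eq_le => /andP[].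
have : projT1 p = projT1 q.
  apply: weak_exponent_inj; apply: card_eq_trans (card_graph q).
  by rewrite -pq; exact: card_esym.
case: p q pq {card_graph} => [L f] [M g] /= pq LM; case: M / LM g pq => g pq.
congr existT; apply/funext => l.
have [m _ [/jI -> //]] : graph (existT _ L g) (j L (\val l), f l).
by rewrite -pq; exists l.
Qed.

(** A small subset is the range of a function on the chosen set of its own cardinal, and that
    function determines it. *)
Lemma subsets_lt_le_weak_power (A K : Type) :
  subsets_lt K A #<= [set: weak_power A K].
Proof.
rewrite -(card_le_eql (card_setT _)).
have /choice[e eP] : forall S : set_type (subsets_lt K A),
    exists p : weak_power A K, range (projT2 p) = \val S.
  move=> S; have [L [[LK LS] _]] := cards_belowP (set_valP S).
  have [f [g fK gK]] : exists f : L -> \val S, bijective f by exact/card_bijP.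
  exists (@existT _ (fun L : set_type (cards_below K) => set_type (\val L) -> A)
    (SigSub (mem_set LK)) (fun l => \val (f l))).
  apply/seteqP; split=> [_ [l _ <-]|x Sx]; first exact: set_valP.
  by exists (g (SigSub (mem_set Sx))) => //=; rewrite gK.
apply: (inj_card_leT (f := e)) => S S' eSS'.
by apply: val_inj; rewrite -eP eSS' eP.
Qed.

Lemma card_set_fun_bool (A : Type) : [set: set A] #= [set: A -> bool].
Proof.
apply: Cantor_Bernstein.
  apply: (inj_card_leT (f := fun (S : set A) x => `[< S x >])) => S S' e.
  apply/predeqP => x; have := congr1 (@^~ x) e.
  by move=> /= eSx; split=> /asboolP Sx; apply/asboolP; rewrite ?eSx // -eSx.
apply: (inj_card_leT (f := fun (f : A -> bool) => [set x | f x])) => f g e.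
by apply/funext => x; apply: is_true_inj; exact: (congr1 (fun S : set A => S x) e).
Qed.

Lemma subsets_lt_succ (A K : Type) : card_succ A #<= [set: K] ->
  subsets_lt K A = setT.
Proof.
move=> AK; apply/seteqP; split=> // S _.
have [[AS nSA] _] := card_succP A.
apply: card_le_lt (card_leT S) _; split; first exact: card_le_trans AS AK.
by move=> KA; apply: nSA; exact: card_le_trans AK KA.
Qed.

(** * The weight of the box product *)

Lemma box_base_open (K I : Type) (infK : infinite_set [set: K])
    (X : I -> topologicalType) (B : set (box_product X infK)) :
  box_base K B -> open B.
Proof. by move=> /(basis_box_base infK X).1. Qed.

Lemma basis_nbhs (X : topologicalType) (B : set (set X)) (x : X) (U : set X) :
  basis B -> nbhs x U -> exists V, [/\ B V, V x & V `<=` U].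
Proof. by move=> [_ Bx] /Bx[V [BV Vx] VU]; exists V. Qed.

(* A set G of pairs (i, a) codes the box that constrains the coordinate i to
   the base members numbered by the a with (i, a) in G. *)
Lemma weight_box_product_le (A K I : Type) (infA : infinite_set [set: A])
    (infK : infinite_set [set: K]) (X : I -> topologicalType) :
  (forall i, weight (X i) #<= [set: A]) ->
  weight (box_product X infK) #<= subsets_lt K (I * A).
Proof.
move=> wX; have [a0 _] := infinite_setN0 infA.
pose e i := projT1 (cid (card_le_ex a0 (wX i))).
have e_inj i : set_inj (weight (X i)) (e i).
  by rewrite /e; case: cid => ? [].
pose box (G : set (I * A)) : set (box_product X infK) :=
  [set x | forall i U, weight (X i) U -> G (i, e i U) -> U (x i)].
(* A code may impose infinitely many base members on one coordinate, so [box G] need not be open;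
   only the open ones are kept. *)
have box_basis : basis (box @` subsets_lt K (I * A) `&` open).
  split=> [B []//|x N /(basis_nbhs (basis_box_base infK X))].
  move=> [_ [[U [oU UK] <-] Ux UN]].
  have exV i : exists V, [/\ weight (X i) V, V (x i) & V `<=` U i].
    apply: basis_nbhs; first exact: (weightP (X i)).1.
    by apply: open_nbhs_nbhs; split; [exact: oU|exact: Ux].
  pose V i := projT1 (cid (exV i)).
  have VP i : [/\ weight (X i) (V i), V i (x i) & V i `<=` U i].
    by rewrite /V; case: cid.
  pose supp := [set i | U i <> setT].
  pose G := [set (i, e i (V i)) | i in supp].
  (* [G] has one pair over each [i] in [supp], and injectivity of [e i] recovers [V i] from it. *)
  have boxG y : box G y <-> forall i, supp i -> V i (y i).
    split=> [Gy i Ui|Vy i W wW [k Uk [ki]]].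
      by apply: Gy; [have [] := VP i|exists i].
    case: i / ki W wW => W wW eVW.
    have [wV _ _] := VP k.
    by rewrite -(e_inj k _ _ (mem_set wV) (mem_set wW) eVW); exact: Vy.
  exists (box G) => /=; last first.
    move=> y /boxG Vy; apply: UN => i; have [->//|Ui] := pselect (U i = setT).
    by have [_ _] := VP i; apply; exact: Vy.
  split; last by apply/boxG => i _; have [] := VP i.
  split.
    exists G => //; apply: card_le_lt UK; exact: card_image_le.
  apply: box_base_open; exists (fun i => if `[< supp i >] then V i else setT).
    split=> [i|].
      case: asboolP => _; last exact: openT.
      by have [wV _ _] := VP i; exact: (weightP (X i)).1.1.
    apply: card_le_lt UK; apply: subset_card_le => i /=.
    by case: asboolP.
  apply/seteqP; split=> y /=.
    by move=> Vy; apply/boxG => i Ui; have := Vy i; case: asboolP.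
  by move=> /boxG Vy i; case: asboolP => // /Vy.
have [_ /(_ _ box_basis) le] := weightP (box_product X infK).
apply: card_le_trans le _; apply: card_le_trans (card_image_le box _).
by apply: subset_card_le => B [].
Qed.

(** The preimage of [true] is open in the subspace, hence the trace of an open set of [X], which
    misses the point of [false]. *)
Lemma two_point_open (X : topologicalType) : contains_two_point_discrete X ->
  exists pqV : X * X * set X, [/\ open pqV.2, pqV.2 pqV.1.2 & ~ pqV.2 pqV.1.1].
Proof.
move=> [S [f [g [fK gK fc gc]]]].
have [V oV VE] : open (f @^-1` [set true]).
  by apply: open_comp => [x _|]; [exact: fc|exact: discrete_open].
exists (\val (g false), \val (g true), V); split=> //=.
  have : (val @^-1` V) (g true) by rewrite VE /= gK.
  by [].
move=> Vf; have : (val @^-1` V) (g false) by [].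
by rewrite VE /= gK.
Qed.

(* Points are indexed by subsets of I; a base member around the point of S
   inside the box that forces the second value on S determines S. *)
Lemma weight_box_product_ge (K I : Type) (infK : infinite_set [set: K])
    (X : I -> topologicalType) :
  (forall i, contains_two_point_discrete (X i)) ->
  subsets_lt K I #<= weight (box_product X infK).
Proof.
move=> twoX.
pose t i := projT1 (cid (two_point_open (twoX i))).
have tP i : [/\ open (t i).2, (t i).2 (t i).1.2 & ~ (t i).2 (t i).1.1].
  by rewrite /t; case: cid.
pose pt (S : set I) : box_product X infK :=
  fun i => if `[< S i >] then (t i).1.2 else (t i).1.1.
pose box (S : set I) : set (box_product X infK) :=
  [set x | forall i, (if `[< S i >] then (t i).2 else setT) (x i)].
have box_pt S S' : box S (pt S') -> S `<=` S'.
  (* At [i] in [S] the value of [pt S'] must lie in the open set, which excludes the first point. *)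
  move=> + i Si => /(_ i); rewrite /pt; case: (asboolP (S i)) => // _.
  by case: (asboolP (S' i)) => // _; have [] := tP i.
have /choice[b bP] : forall S, exists B, subsets_lt K I S ->
    [/\ weight (box_product X infK) B, B (pt S) & B `<=` box S].
  move=> S; have [SK|nSK] := pselect (subsets_lt K I S); last by exists set0.
  have [B BP] : exists B,
      [/\ weight (box_product X infK) B, B (pt S) & B `<=` box S].
    apply: basis_nbhs; first exact: (weightP (box_product X infK)).1.
    apply: open_nbhs_nbhs; split; last first.
      move=> i; rewrite /pt; case: asboolP => // _; by have [] := tP i.
    apply: box_base_open.
    exists (fun i => if `[< S i >] then (t i).2 else setT) => //; split=> [i|].
      by case: asboolP => _; [have [] := tP i|exact: openT].
    apply: card_le_lt SK; apply: subset_card_le => i /=.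
    by case: asboolP.
  by exists B.
apply: (@card_le_fun _ _ _ _ b) => [S /bP[]//|S S' /set_mem SK /set_mem S'K bSS'].
have [_ bS bSbox] := bP _ SK; have [_ bS' bS'box] := bP _ S'K.
apply/seteqP; split; apply: box_pt; first by apply: bSbox; rewrite bSS'.
by apply: bS'box; rewrite -bSS'.
Qed.

(** Both bounds are carried over to subsets of [A], as [I] is equipotent to [A] and [A * A] embeds
    in [A]. *)
Lemma weight_box_product (A K I : Type) (infA : infinite_set [set: A])
    (infK : infinite_set [set: K]) (X : I -> topologicalType) :
  [set: I] #= [set: A] ->
  (forall i, contains_two_point_discrete (X i)) ->
  (forall i, weight (X i) #<= [set: A]) ->
  weight (box_product X infK) #= subsets_lt K A.
Proof.
move=> IA twoX wX; have [a0 _] := infinite_setN0 infA.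
move: (IA); rewrite card_eq_le => /andP[/(card_leT_inj a0)[f f_inj] AI].
have infI : infinite_set [set: I] by move=> /(card_le_finite AI).
have [i0 _] := infinite_setN0 infI.
have [g g_inj] := card_leT_inj i0 AI.
apply: Cantor_Bernstein; last first.
  exact: card_le_trans (subsets_lt_le K g_inj) (weight_box_product_ge infK twoX).
have [h h_inj] := card_leT_inj a0 (card_le_square infA).
apply: card_le_trans (weight_box_product_le infA infK wX) _.
apply: (subsets_lt_le K (f := fun p => h (f p.1, p.2))).
by move=> [i a] [j b] /h_inj [/f_inj -> ->].
Qed.

Theorem theorem3p10 (A K I : Type)
  (infA : infinite_set [set: A]) (infK : infinite_set [set: K])
  (X : I -> topologicalType)
  (cardI : [set: I] #= [set: A])
  (twoX : forall i : I, contains_two_point_discrete (X i))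
  (wX : forall i : I, weight (X i) #<= [set: A]) :
  ([set: K] #<= card_succ A ->
    weight (box_product X infK) #= [set: weak_power A K]) /\
  (card_succ A #<= [set: K] ->
    weight (box_product X infK) #= [set: A -> bool]).
Proof.
have wE := weight_box_product infA infK cardI twoX wX.
have [a0 _] := infinite_setN0 infA.
split=> KA; apply: card_eq_trans wE _; last first.
  by rewrite subsets_lt_succ //; exact: card_set_fun_bool.
apply: Cantor_Bernstein; first exact: subsets_lt_le_weak_power.
(* Graphs are subsets of [A * A]; [h] turns them into subsets of [A]. *)
have [h h_inj] := card_leT_inj a0 (card_le_square infA).
exact: card_le_trans (weak_power_le a0 KA) (subsets_lt_le K h_inj).
Qed.
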